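(* Let $N\in\mathbb{N}$, $N\ge1$, $D_N=\frac{3N(N+1)}{2}$, and let $\{\psi_{N,j}(r,\phi)\}_{j=1}^{D_N}$ be the wavelets $$\psi_{N,j}(r,\phi)=K_{2N}(r,\phi;\mu_j^{(N)},\omega_j^{(N)})-K_N(r,\phi;\mu_j^{(N)},\omega_j^{(N)})=\sum_{n=N+1}^{2N}\ \sum_{\substack{m=-n\\ n-m\ \mathrm{even}}}^{n}\overline{Z_n^m(\mu_j^{(N)},\omega_j^{(N)})}\,Z_n^m(r,\phi)$$ with respect to a set of parameter points $\{(\mu_j^{(N)},\omega_j^{(N)})\}_{j=1}^{D_N}$ in $B(0,1)$ (in polar coordinates). Then the following hold. (i) $\langle\psi_{N,j},\psi_{N,k}\rangle=\psi_{N,k}(\mu_j^{(N)},\omega_j^{(N)})$ for all $j,k\in\{1,\dots,D_N\}$. (ii) The wavelet $\psi_{N,j}$ is localized around $(\mu_j^{(N)},\omega_j^{(N)})$, i.e. $$\left\|\frac{\psi_{N,j}(r,\phi)}{\psi_{N,j}(\mu_j^{(N)},\omega_j^{(N)})}\right\|=\min\{\|\psi\|:\psi\in W_N,\ \psi(\mu_j^{(N)},\omega_j^{(N)})=1\}.$$ (iii) Let $J_N=\frac{(N+1)(N+2)}{2}$ and let $\{\phi_{N,k}\}_{k=1}^{J_N}$, $\phi_{N,k}(r,\phi)=K_N(r,\phi;\rho_k^{(N)},\theta_k^{(N)})$, be the scaling functions in $V_N$ based on a set of regular points $\{(\rho_k^{(N)},\theta_k^{(N)})\}_{k=1}^{J_N}$.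 Then the wavelets and scaling functions are orthogonal: $$\langle\psi_{N,j},\phi_{N,k}\rangle=0,\qquad j=1,\dots,D_N,\ k=1,\dots,J_N.$$
   Context: Points of the closed unit disk $B(0,1)=\{(x,y)\in\mathbb{R}^2: x^2+y^2\le 1\}$ are written in polar coordinates $(r,\phi)$, $0\le r\le 1$, $0\le\phi<2\pi$. The inner product on $L^2(B(0,1))$ is $\langle f,g\rangle=\int_0^1\int_0^{2\pi}f(r,\phi)\overline{g(r,\phi)}\,r\,d\phi\,dr$, with norm $\|\cdot\|$. $V_N$ is the complex vector space of all polynomials in two variables $x,y$ of total degree at most $N$, regarded as functions on $B(0,1)$. Zernike polynomials: for $n\in\mathbb{N}_0$ and $m\in\mathbb{Z}$ with $|m|\le n$ and $n-m$ even, $$Z_n^m(r,\phi)=\sqrt{\tfrac{n+1}{\pi}}\;R_n^{|m|}(r)\,e^{im\phi},\qquad R_n^{|m|}(r)=\sum_{s=0}^{(n-|m|)/2}\frac{(-1)^s(n-s)!}{s!\,\big(\frac{n+|m|}{2}-s\big)!\,\big(\frac{n-|m|}{2}-s\big)!}\,r^{n-2s}.$$ Kernel polynomial with parameter $(\rho,\theta)$: $K_N(r,\phi;\rho,\theta)=\sum_{n=0}^{N}\sum_{m=-n,\ n-m\ \mathrm{even}}^{n}\overline{Z_n^m(\rho,\theta)}\,Z_n^m(r,\phi)$. Wavelet space: $W_N=V_{2N}\ominus V_N$ is the orthogonal complement of $V_N$ in $V_{2N}$, i.e. $W_N=\mathrm{span}\{Z_n^m: N+1\le n\le 2N,\ |m|\le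 n,\ n-m\text{ even}\}$; its dimension is $D_N=\frac{3N(N+1)}{2}$. Regular points: given $N$, set $k=\lfloor N/2\rfloor+1$. Take radii $1>\lambda_1>\cdots>\lambda_k\ge 0$ given by $\lambda_i=1.1565\,\zeta_i-0.76535\,\zeta_i^2+0.60517\,\zeta_i^3$, where $\zeta_i=\cos\frac{(2i-1)\pi}{2(N+1)}$, $1\le i\le k$. On the circle of radius $\lambda_i$ centered at the origin choose $n_i=2N+5-4i$ equally spaced points, $1\le i\le k$ (if $\lambda_k=0$, which happens for $N$ even, then $n_k=1$ and the point is the origin). This gives in total $J_N=\frac{(N+1)(N+2)}{2}$ points, and such a set is called a set of regular points. *)

(* Defs.v *)
From HB Require Import structures.
From mathcomp Require Import all_boot all_order all_algebra.
From mathcomp Require Import all_classical all_reals all_analysis.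
From mathcomp Require Import complex.
(* The notations of mpoly clash with those of mathcomp-analysis. *)
From mathcomp Require Import -(notations) mpoly.

Set Implicit Arguments.
Unset Strict Implicit.
Unset Printing Implicit Defensive.

Import Order.TTheory GRing.Theory Num.Theory.
Import numFieldNormedType.Exports.

Local Open Scope classical_set_scope.
Local Open Scope complex_scope.
Local Open Scope ring_scope.

(* A function on the closed unit disk is represented by a function of the polar
   coordinates (r, phi); only its values on 0 <= r <= 1, 0 <= phi < 2 pi matter. *)
Definition polar_fun (R : realType) : Type := R -> R -> R[i].

Definition in_disk (R : realType) (r phi : R) : Prop :=
  0 <= r <= 1 /\ 0 <= phi < 2 * pi.

Definition cart (R : realType) (r phi : R) : R * R :=
  (r * cos phi, r * sin phi).

Definition Cintegral (R : realType) (A : set R) (f : R -> R[i]) : R[i] :=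
  (\int[@lebesgue_measure R]_(x in A) complex.Re (f x))
  +i* (\int[@lebesgue_measure R]_(x in A) complex.Im (f x)).

Definition inner (R : realType) (f g : polar_fun R) : R[i] :=
  Cintegral `[0, 1] (fun r =>
    Cintegral `[0, 2 * pi[ (fun phi => f r phi * (g r phi)^* * r%:C)).

Definition L2norm (R : realType) (f : polar_fun R) : R :=
  Num.sqrt (complex.Re (inner f f)).

(* [msize p] is the total degree of p plus one, and 0 for p = 0. *)
Definition V (R : realType) (N : nat) : set (polar_fun R) :=
  [set f | exists p : mpoly 2 R[i],
     (msize p <= N.+1)%N /\
     forall r phi : R, in_disk r phi ->
       f r phi = meval
         (fun i : 'I_2 => (if i == ord0 then (cart r phi).1
                           else (cart r phi).2)%:C) p].

Definition W (R : realType) (N : nat) : set (polar_fun R) :=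
  [set f | V (2 * N) f /\ forall g, V N g -> inner f g = 0].

(* The halvings and subtractions on nat are exact when m <= n and n - m is
   even, the only case in which radial is used. *)
Definition radial (R : realType) (n m : nat) (r : R) : R :=
  \sum_(s < ((n - m)./2).+1)
    (-1) ^+ s * ((n - s)`!)%:R
    / ((s`!)%:R * (((n + m)./2 - s)`!)%:R * (((n - m)./2 - s)`!)%:R)
    * r ^+ (n - 2 * s).

Definition expi (R : realType) (t : R) : R[i] := cos t +i* sin t.

Definition zernike (R : realType) (n : nat) (m : int) : polar_fun R :=
  fun r phi => (Num.sqrt (n.+1%:R / pi))%:C * (radial n `|m|%N r)%:C
               * expi (m%:~R * phi).

(* The integers m with -n <= m <= n and n - m even. *)
Definition zernike_range (n : nat) : seq int :=
  [seq m <- [seq i%:Z - n%:Z | i <- iota 0 (2 * n).+1] | (2 %| n%:Z - m)%Z].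

Definition kernel_poly (R : realType) (N : nat) (rho theta : R) : polar_fun R :=
  fun r phi => \sum_(0 <= n < N.+1) \sum_(m <- zernike_range n)
    (zernike n m rho theta)^* * zernike n m r phi.

Definition wavelet (R : realType) (N : nat) (mu omega : R) : polar_fun R :=
  fun r phi => kernel_poly (2 * N) mu omega r phi - kernel_poly N mu omega r phi.

Lemma waveletE (R : realType) (N : nat) (mu omega r phi : R) :
  wavelet N mu omega r phi =
  \sum_(N.+1 <= n < (2 * N).+1) \sum_(m <- zernike_range n)
    (zernike n m mu omega)^* * zernike n m r phi.
Proof.
rewrite /wavelet /kernel_poly (@big_cat_nat _ _ _ N.+1 0 (2 * N).+1) //=.
  by rewrite addrAC subrr add0r.
by rewrite ltnS leq_pmull.
Qed.

Definition dimW (N : nat) : nat := (3 * N * N.+1) %/ 2.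

Definition dimV (N : nat) : nat := (N.+1 * N.+2) %/ 2.

Definition zeta (R : realType) (N i : nat) : R :=
  cos ((2 * i - 1)%:R * pi / (2 * N.+1)%:R).

Definition lambda (R : realType) (N i : nat) : R :=
  let z := zeta R N i in
  11565%:R / 10%:R ^+ 4 * z - 76535%:R / 10%:R ^+ 5 * z ^+ 2
  + 60517%:R / 10%:R ^+ 5 * z ^+ 3.

(* [alpha i] is the angular position, left free, of the equally spaced points on
   the i-th circle.  The right-hand set has dimV N elements, so the family
   (rho, theta) enumerates it without repetition. *)
Definition regular_points (R : realType) (N : nat)
    (rho theta : 'I_(dimV N) -> R) : Prop :=
  (forall k, in_disk (rho k) (theta k)) /\
  exists alpha : nat -> R,
    range (fun k => cart (rho k) (theta k)) =
    \bigcup_(i in [set i : nat | (1 <= i <= (N %/ 2).+1)%N])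
      [set cart (lambda R N i)
             (alpha i + 2 * pi * l%:R / (2 * N + 5 - 4 * i)%:R)
       | l in `I_(2 * N + 5 - 4 * i)].

Definition is_min (R : realType) (A : set R) (x : R) : Prop :=
  A x /\ lbound A x.

(* Main.v *)
(* The Zernike functions Z_n^m with n <= N form an orthonormal basis of V_N.
   Orthogonality in m is that of the exponentials.  For fixed m and n = m + 2b,
   pairing R_n^m with r^(m+2j) gives, up to a constant, the b-th alternating
   difference in t of (m+t+1)...(m+t+b) / (m+t+j+1), which is an explicit
   product that vanishes for j < b.  They span V_N because x and y are linear in
   z = r e^(i phi) and its conjugate, and r^(m+2t) e^(i m phi) is triangular with
   respect to the Z_(m+2b)^m with b <= t.

   Hence <f, psi_j> is the value of f at the j-th point for every f in W_N, and
   (ii) is the equality case of Cauchy-Schwarz.  Part (i) also needs psi_j to be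
   real, that is, the symmetry m -> -m. *)
Require Import Defs.
From mathcomp Require Import all_boot all_order all_algebra.
From mathcomp Require Import all_classical all_reals all_analysis.
From mathcomp Require Import complex ring zify.
From mathcomp Require Import -(notations) mpoly.

Set Implicit Arguments.
Unset Strict Implicit.
Unset Printing Implicit Defensive.

Import Order.TTheory GRing.Theory Num.Theory.
Import numFieldNormedType.Exports.

Local Open Scope classical_set_scope.
Local Open Scope ring_scope.

(** * Radial polynomials *)

Section FiniteDifferences.
Variable F : numFieldType.
Implicit Types (g : nat -> F) (x z : F).

(** This is $(-1)^b$ times the [b]-th forward difference of [g] at 0, the shape in which the radial
    coefficients produce it. *)
Definition alt_diff b g : F := \sum_(t < b.+1) (-1) ^+ t * 'C(b, t)%:R * g t.

Lemma alt_diff_ext b g h : g =1 h -> alt_diff b g = alt_diff b h.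
Proof. by move=> gh; apply: eq_bigr => t _; rewrite gh. Qed.

Lemma alt_diffS b g :
  alt_diff b.+1 g = alt_diff b g - alt_diff b (fun t => g t.+1).
Proof.
(* Padding with the vanishing term $t = b+1$ aligns the ranges, so that Pascal's rule applies
   termwise. *)
have -> : alt_diff b g = \sum_(t < b.+2) (-1) ^+ t * 'C(b, t)%:R * g t.
  by rewrite big_ord_recr /= bin_small // mulr0 mul0r addr0.
rewrite /alt_diff big_ord_recl [in RHS]big_ord_recl /= !bin0 -addrA.
congr (_ + _); rewrite -sumrB; apply: eq_bigr => t _ /=.
by rewrite /bump /= add1n binS natrD exprS; ring.
Qed.

Lemma alt_diffD b g h :
  alt_diff b (fun t => g t + h t) = alt_diff b g + alt_diff b h.
Proof. by rewrite -big_split; apply: eq_bigr => t _; rewrite mulrDr. Qed.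

Lemma alt_diffB b g h :
  alt_diff b (fun t => g t - h t) = alt_diff b g - alt_diff b h.
Proof. by rewrite -sumrB; apply: eq_bigr => t _; rewrite mulrBr. Qed.

Lemma alt_diffZ b c g : alt_diff b (fun t => c * g t) = c * alt_diff b g.
Proof. by rewrite mulr_sumr; apply: eq_bigr => t _; rewrite mulrCA. Qed.

(** The Pochhammer symbol $(x+1)_p$; at a natural number $q$ it is $(q+p)!/q!$. *)
Definition rising p x : F := \prod_(i < p) (x + i.+1%:R).

(** Both products contain $(x+2)\cdots(x+p+1)$; the remaining factors $x+p+2$ and $x+1$ differ by
    $p+1$. *)
Lemma rising_shift p x : rising p.+1 (x + 1) - rising p.+1 x =
  p.+1%:R * rising p (x + 1).
Proof.
rewrite /rising [X in X - _]big_ord_recr /= [X in _ - X]big_ord_recl /=.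
under [X in _ - _ * X]eq_bigr => i _.
  have -> : x + (bump 0 i).+1%:R = x + 1 + i.+1%:R.
    by rewrite /bump /= add1n [i.+2%:R]mulrS addrA.
  over.
by rewrite /= [p.+1%:R]mulrS; ring.
Qed.

(** A polynomial of degree $p$ in $t$ is killed by more than $p$ differences: each one lowers the
    degree by [rising_shift], moving the base point [x], which the induction therefore
    generalizes. *)
Lemma alt_diff_rising p b x : (p < b)%N ->
  alt_diff b (fun t => rising p (x + t%:R)) = 0.
Proof.
elim: b p x => // b IHb p x; rewrite ltnS => pb.
rewrite alt_diffS -alt_diffB; case: p pb => [|p] pb.
  by rewrite /alt_diff big1 // => t _; rewrite /rising !big_ord0 subrr mulr0.
rewrite (@alt_diff_ext _ _ (fun t => - p.+1%:R * rising p (x + 1 + t%:R))).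
  by rewrite alt_diffZ IHb ?mulr0.
move=> t; rewrite -[t.+1]addn1 natrD addrA -opprB rising_shift -mulNr.
by congr (_ * rising _ _); rewrite addrAC.
Qed.

(** This is the partial fraction expansion of $b!/(x(x+1)\cdots(x+b))$, by induction from the
    expansions at $x$ and $x+1$. *)
Lemma alt_diff_inv b x : (forall t, (t <= b)%N -> x + t%:R != 0) ->
  alt_diff b (fun t => (x + t%:R)^-1) = b`!%:R / \prod_(t < b.+1) (x + t%:R).
Proof.
elim: b x => [|b IHb] x hx.
  by rewrite /alt_diff !big_ord1 bin0 mulr1 expr0.
rewrite alt_diffS IHb; last by move=> t tb; apply/hx/leqW.
rewrite (@alt_diff_ext _ _ (fun t => (x + 1 + t%:R)^-1)); last first.
  by move=> t; rewrite [t.+1%:R]mulrS addrA.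
rewrite IHb; last by move=> t tb; rewrite -addrA -mulrS; apply: hx.
have hx' t : (t <= b)%N -> x + t.+1%:R != 0 by move=> tb; apply: hx.
rewrite [\prod_(t < b.+1) (x + t%:R)]big_ord_recl.
rewrite [\prod_(t < b.+2) (x + t%:R)]big_ord_recl /=.
rewrite [in RHS]big_ord_recr /=.
rewrite [\prod_(t < b.+1) (x + 1 + _)]big_ord_recr /=.
have -> : \prod_(t < b) (x + 1 + t%:R) = \prod_(t < b) (x + (bump 0 t)%:R).
  by apply: eq_bigr => t _; rewrite /bump add1n mulrS addrA.
have -> : \prod_(t < b) (x + (bump 0 (widen_ord (leqnSn b) t))%:R) =
  \prod_(t < b) (x + (bump 0 t)%:R) by [].
(* [P] is $(x+1)\cdots(x+b)$, the part common to the denominators for $x$ and $x+1$. *)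
set P := \prod_(_ < _) _.
have P0 : P != 0.
  by apply/prodf_neq0 => t _; rewrite /bump add1n; apply/hx'/ltnW.
have := hx 0 isT; have := hx' b (leqnn _); rewrite /bump add1n addr0.
rewrite factS natrM [b.+1%:R]mulrS => h1 h0.
by field; rewrite h1 P0 h0.
Qed.

(* Dividing [rising p.+1 x] by [x + z] leaves the remainder [rising p.+1 (- z)]
   up to polynomials of degree at most p, which [alt_diff b] kills. *)
Lemma alt_diff_rising_div p b x z : (p <= b)%N ->
  (forall t, (t <= b)%N -> x + z + t%:R != 0) ->
  alt_diff b (fun t => rising p (x + t%:R) / (x + z + t%:R)) =
  b`!%:R * rising p (- z) / \prod_(t < b.+1) (x + z + t%:R).
Proof.
move=> pb hx; elim: p pb => [|p IHp] pb.
  rewrite /rising big_ord0 mulr1 -alt_diff_inv //; apply: alt_diff_ext => t.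
  by rewrite big_ord0 mul1r.
(* The last factor $x+t+p+1$ splits as $(x+z+t)+(p+1-z)$: the first part cancels the denominator and
   the second extends the remainder. *)
have -> : alt_diff b (fun t => rising p.+1 (x + t%:R) / (x + z + t%:R)) =
  alt_diff b (fun t => rising p (x + t%:R) +
    (p.+1%:R - z) * (rising p (x + t%:R) / (x + z + t%:R))).
  apply: eq_bigr => t _; congr (_ * _).
  have := hx t; rewrite -ltnS ltn_ord => /(_ isT) h.
  by rewrite /rising big_ord_recr /=; field.
rewrite alt_diffD alt_diff_rising // add0r alt_diffZ IHp ?(ltnW pb) //.
by rewrite /rising [in RHS](big_ord_recr p) /=; ring.
Qed.

End FiniteDifferences.

(** * Coefficients and moments of the radial polynomials *)

Section Radial.
Variable R : realType.

(* The coefficient of [r ^+ (m + 2 * t)] in [radial (m + 2 * b) m r]: the index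
   [s] of [radial] is [b - t]. *)
Definition radial_coef (m b t : nat) : R :=
  (-1) ^+ b / b`!%:R * ((-1) ^+ t * 'C(b, t)%:R * rising b (m%:R + t%:R)).

Lemma rising_fact p q : q`!%:R * rising p q%:R = (q + p)`!%:R :> R.
Proof.
elim: p => [|p IHp]; first by rewrite /rising big_ord0 mulr1 addn0.
by rewrite /rising big_ord_recr /= mulrA IHp -natrD -natrM mulnC addnS -factS.
Qed.

(** Writing $n = m+2b$ makes all halvings exact, and $(m+t+b)!/(m+t)!$ becomes a rising factorial,
    which exposes an alternating difference. *)
Lemma radialE m b (r : R) : radial (m + 2 * b) m r =
  \sum_(t < b.+1) radial_coef m b t * r ^+ (m + 2 * t).
Proof.
rewrite /radial; have -> : ((m + 2 * b - m)./2 = b)%N by lia.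
have -> : ((m + 2 * b + m)./2 = m + b)%N by lia.
rewrite (reindex_inj rev_ord_inj); apply: eq_bigr => t _ /=.
have tb : (t <= b)%N by rewrite -ltnS.
rewrite subSS.
have -> : (m + 2 * b - 2 * (b - t) = m + 2 * t)%N by lia.
have -> : (m + 2 * b - (b - t) = m + t + b)%N by lia.
have -> : (m + b - (b - t) = m + t)%N by lia.
have -> : (b - (b - t) = t)%N by lia.
congr (_ * _); rewrite /radial_coef -natrD -rising_fact -(bin_fact tb) !natrM.
(* Passing to parities turns $(-1)^{b-t}$ into $(-1)^b(-1)^t$ despite the truncated subtraction. *)
rewrite -signr_odd oddB // signr_addb !signr_odd.
have f0 k : k`!%:R != 0 :> R by rewrite pnatr_eq0 -lt0n fact_gt0.
have C0 : 'C(b, t)%:R != 0 :> R by rewrite pnatr_eq0 -lt0n bin_gt0.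
by field; rewrite !f0 C0.
Qed.

Lemma radial_coef_lead m b : radial_coef m b b = rising b (m + b)%:R / b`!%:R.
Proof.
rewrite /radial_coef binn mulr1 natrD.
by rewrite mulrACA -expr2 sqrr_sign mul1r mulrC.
Qed.

(** The diagonal of the triangular change of basis between modes and Zernike functions is
    invertible. *)
Lemma radial_coef_lead_neq0 m b : radial_coef m b b != 0.
Proof.
rewrite radial_coef_lead; apply: mulf_neq0; last first.
  by rewrite invr_eq0 pnatr_eq0 -lt0n fact_gt0.
by apply/prodf_neq0 => i _; rewrite -natrD pnatr_eq0 addnS.
Qed.

(** The sum is $\int_0^1 R_{m+2b}^m(r)\,r^{m+2j}\,r\,dr$. Its denominators are $2(m+j+1+t)$, so
    [alt_diff_rising_div] applies with $p=b$, $x=m$, $z=j+1$. *)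
Lemma radial_moment m b j :
  \sum_(t < b.+1) radial_coef m b t / (m + 2 * t + (m + 2 * j) + 2)%:R =
  (-1) ^+ b * rising b (- j.+1%:R)
    / \prod_(t < b.+1) ((m + j).+1 + t)%:R / 2.
Proof.
have f0 : b`!%:R != 0 :> R by rewrite pnatr_eq0 -lt0n fact_gt0.
have := @alt_diff_rising_div R b b m%:R j.+1%:R (leqnn b).
have h0 t : m%:R + j.+1%:R + t%:R != 0 :> R.
  by rewrite -!natrD pnatr_eq0 addnS.
move=> /(_ (fun t _ => h0 t)); rewrite /alt_diff => e.
have -> : \prod_(t < b.+1) ((m + j).+1 + t)%:R =
    \prod_(t < b.+1) (m%:R + j.+1%:R + t%:R) :> R.
  by apply: eq_bigr => t _; rewrite -!natrD addnS.
transitivity ((-1) ^+ b / b`!%:R *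
  (b`!%:R * rising b (- j.+1%:R) /
   \prod_(t < b.+1) (m%:R + j.+1%:R + t%:R)) / 2 : R); last first.
  have P0 : \prod_(t < b.+1) (m%:R + j.+1%:R + t%:R) != 0 :> R.
    by apply/prodf_neq0.
  by field; rewrite P0 f0.
rewrite -e mulr_sumr mulr_suml; apply: eq_bigr => t _.
have -> : (m + 2 * t + (m + 2 * j) + 2)%:R = 2 * (m%:R + j.+1%:R + t%:R) :> R.
  by rewrite -!natrD -natrM; congr _%:R; lia.
have := h0 t.
by rewrite /radial_coef => ht; field; rewrite nat1r ht f0.
Qed.

(** For $j<b$ the product [rising b (- j.+1%:R)] contains the zero factor $-(j+1)+(j+1)$. *)
Lemma radial_moment0 m b j : (j < b)%N ->
  \sum_(t < b.+1) radial_coef m b t / (m + 2 * t + (m + 2 * j) + 2)%:R = 0.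
Proof.
move=> jb; rewrite radial_moment /rising (bigD1 (Ordinal jb)) //= addNr.
by rewrite mul0r mulr0 !mul0r.
Qed.

(** This is the squared radial norm: lower powers in the second factor integrate to 0, so only its
    leading coefficient contributes. *)
Lemma radial_moment_lead m b :
  radial_coef m b b *
  \sum_(t < b.+1) radial_coef m b t / (m + 2 * t + (m + 2 * b) + 2)%:R =
  (2 * (m + 2 * b).+1%:R)^-1.
Proof.
(* The factors of [rising b (- b.+1%:R)] are $-b,\dots,-1$; reversing them and absorbing the signs
   gives $b!$. *)
have rb : (-1) ^+ b * rising b (- b.+1%:R) = b`!%:R :> R.
  rewrite fact_prod natr_prod big_add1 /= big_mkord.
  rewrite -[X in _ ^+ X]card_ord -prodr_const -big_split /=.
  rewrite (reindex_inj rev_ord_inj); apply: eq_bigr => i _ /=.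
  rewrite mulN1r opprD opprK -natrB; first by congr _%:R; have := ltn_ord i; lia.
  by have := ltn_ord i; lia.
rewrite radial_moment rb radial_coef_lead big_ord_recr /=.
have -> : \prod_(i < b) ((m + b).+1 + i)%:R = rising b (m + b)%:R :> R.
  by apply: eq_bigr => i _; rewrite -natrD addSnnS.
have -> : ((m + b).+1 + b = (m + 2 * b).+1)%N by lia.
have f0 : b`!%:R != 0 :> R by rewrite pnatr_eq0 -lt0n fact_gt0.
have r0 : rising b (m + b)%:R != 0 :> R.
  by apply/prodf_neq0 => i _; rewrite -natrD pnatr_eq0 addnS.
have n0 : (m + 2 * b).+1%:R != 0 :> R by rewrite pnatr_eq0.
by move: (m + 2 * b).+1%:R n0 => k n0; field; rewrite f0 r0 n0.
Qed.

End Radial.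

(** * Integrals of trigonometric polynomials and the inner product *)

Section ComplexIntegral.
Variable R : realType.
Local Notation mu := (@lebesgue_measure R).
Implicit Types (f g : R -> R[i]).

Definition Cintegrable (A : set R) f :=
  mu.-integrable A (EFin \o (fun x => complex.Re (f x))) /\
  mu.-integrable A (EFin \o (fun x => complex.Im (f x))).

Lemma eq_Cintegral (A : set R) f g : {in A, f =1 g} ->
  Cintegral A f = Cintegral A g.
Proof. by move=> fg; congr (_ +i* _)%C; apply: eq_Rintegral => x xA; rewrite fg. Qed.

Lemma Cintegral0 (A : set R) : Cintegral A (fun=> 0 : R[i]) = 0.
Proof.
by rewrite /Cintegral /Rintegral !integral0_eq.
Qed.

Lemma CintegrableD (A : set R) f g : measurable (A : set (measurableTypeR R)) ->
  Cintegrable A f -> Cintegrable A g -> Cintegrable A (fun x => f x + g x).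
Proof.
move=> mA [fr fi] [gr gi]; split.
  have := integrableD mA fr gr; apply: eq_integrable => // x _ /=.
  by case: (f x) (g x) => [a b] [c d].
have := integrableD mA fi gi; apply: eq_integrable => // x _ /=.
by case: (f x) (g x) => [a b] [c d].
Qed.

Lemma CintegralD (A : set R) f g : measurable (A : set (measurableTypeR R)) ->
  Cintegrable A f -> Cintegrable A g ->
  Cintegral A (fun x => f x + g x) = Cintegral A f + Cintegral A g.
Proof.
move=> mA [fr fi] [gr gi]; rewrite /Cintegral.
have -> : (fun x => complex.Re (f x + g x)) =
    (fun x => complex.Re (f x) + complex.Re (g x)).
  by apply/funext => x; case: (f x) (g x) => [a b] [c d].
have -> : (fun x => complex.Im (f x + g x)) =
    (fun x => complex.Im (f x) + complex.Im (g x)).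
  by apply/funext => x; case: (f x) (g x) => [a b] [c d].
by rewrite !RintegralD.
Qed.

Lemma ReM (c z : R[i]) : complex.Re (c * z) =
  complex.Re c * complex.Re z - complex.Im c * complex.Im z.
Proof. by case: c z => [a b] [u v]. Qed.

Lemma ImM (c z : R[i]) : complex.Im (c * z) =
  complex.Re c * complex.Im z + complex.Im c * complex.Re z.
Proof. by case: c z => [a b] [u v]. Qed.

Lemma integrableMl (A : set R) (c : R) (f : R -> R) :
  measurable (A : set (measurableTypeR R)) ->
  mu.-integrable A (EFin \o f) -> mu.-integrable A (EFin \o (fun x => c * f x)).
Proof. by move=> mA /(integrableZl mA c). Qed.

Lemma CintegrableZ (A : set R) (c : R[i]) f :
  measurable (A : set (measurableTypeR R)) ->
  Cintegrable A f -> Cintegrable A (fun x => c * f x).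
Proof.
move=> mA [fr fi]; split.
  have := integrableB mA (integrableMl (complex.Re c) mA fr)
                         (integrableMl (complex.Im c) mA fi).
  by apply: eq_integrable => // x _; rewrite /= ReM.
have := integrableD mA (integrableMl (complex.Re c) mA fi)
                       (integrableMl (complex.Im c) mA fr).
by apply: eq_integrable => // x _; rewrite /= ImM.
Qed.

Lemma CintegralZ (A : set R) (c : R[i]) f :
  measurable (A : set (measurableTypeR R)) ->
  Cintegrable A f -> Cintegral A (fun x => c * f x) = c * Cintegral A f.
Proof.
move=> mA [fr fi]; rewrite /Cintegral.
under [X in (X +i* _)%C]eq_Rintegral do rewrite ReM.
under [X in (_ +i* X)%C]eq_Rintegral do rewrite ImM.
rewrite RintegralB ?RintegralD ?RintegralZl //; try exact: integrableMl.
by case: c.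
Qed.

Lemma Cintegral_sum (A : set R) (I : Type) (s : seq I) (c : I -> R[i])
    (f : I -> R -> R[i]) : measurable (A : set (measurableTypeR R)) ->
  (forall i, Cintegrable A (f i)) ->
  Cintegral A (fun x => \sum_(i <- s) c i * f i x) =
  \sum_(i <- s) c i * Cintegral A (f i).
Proof.
move=> mA If.
(* Integrability of the partial sums is carried along because additivity of the integral requires
   it. *)
suff [] : Cintegrable A (fun x => \sum_(i <- s) c i * f i x) /\
  Cintegral A (fun x => \sum_(i <- s) c i * f i x) =
  \sum_(i <- s) c i * Cintegral A (f i) by [].
elim: s => [|i s [IH1 IH2]].
  rewrite big_nil -[RHS](Cintegral0 A); split; last first.
    by apply: eq_Cintegral => x _; rewrite big_nil.
  by split; have := integrable0 mu A; apply: eq_integrable => // x _ /=;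
    rewrite big_nil.
have -> : (fun x => \sum_(j <- i :: s) c j * f j x) =
    (fun x => c i * f i x + \sum_(j <- s) c j * f j x).
  by apply/funext => x; rewrite big_cons.
have Ii := CintegrableZ (c i) mA (If i).
split; first exact: CintegrableD.
by rewrite CintegralD // CintegralZ // IH2 big_cons.
Qed.

Lemma CintegralC (A : set R) (p : R -> R) :
  Cintegral A (fun x => (p x)%:C%C) = (\int[mu]_(x in A) p x)%:C%C.
Proof. by rewrite /Cintegral /= [X in (_ +i* X)%C]/Rintegral integral0_eq. Qed.

Lemma continuous_integrable (a b : R) (f : R -> R) : continuous f ->
  mu.-integrable `[a, b] (EFin \o f).
Proof.
move=> cf; apply: continuous_compact_integrable; first exact: segment_compact.
exact: continuous_subspaceT.
Qed.

Lemma continuous_integrable_co (a b : R) (f : R -> R) : continuous f ->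
  mu.-integrable `[a, b[ (EFin \o f).
Proof.
move=> cf; have := @continuous_integrable a b f cf.
apply: integrableS => //.
exact: subset_itv_co_cc.
Qed.

Lemma continuous_expi (m : int) :
  continuous (fun t : R => cos (m%:~R * t)) /\
  continuous (fun t : R => sin (m%:~R * t)).
Proof.
split=> t; apply: (@continuous_comp _ _ _ (fun t : R => m%:~R * t)).
- exact: mulrl_continuous.
- exact: continuous_cos.
- exact: mulrl_continuous.
- exact: continuous_sin.
Qed.

(** With an antiderivative on the whole line, the one-sided limits at the endpoints follow from its
    continuity. *)
Lemma FTC2_derive (a b : R) (f F : R -> R) : a < b -> continuous f ->
  (forall x : R, is_derive x 1 F (f x)) -> \int[mu]_(x in `[a, b]) f x = F b - F a.
Proof.
move=> ab cf dF.
have dF1 (x : R) : derivable F x 1 by have [] := dF x.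
have cF : continuous F by move=> x; apply/differentiable_continuous/derivable1_diffP.
rewrite /Rintegral (@continuous_FTC2 _ f F) //.
- exact: continuous_subspaceT.
- split=> //.
    exact/cvg_at_right_filter/cF.
  exact/cvg_at_left_filter/cF.
- by move=> x _; rewrite derive1E; have [] := dF x.
Qed.

Lemma Rintegral_pow k : \int[mu]_(r in `[0, 1]) r ^+ k = k.+1%:R^-1 :> R.
Proof.
have dF (x : R) : is_derive x 1 (k.+1%:R^-1 \*: (@id R ^+ k.+1)) (x ^+ k).
  apply: is_derive_eq; rewrite /GRing.scale /= mulr1 mulrA mulVf ?mul1r //.
rewrite (FTC2_derive ltr01 _ dF); last exact: exprn_continuous.
by rewrite /= !exprfctE /GRing.scale /= expr1n expr0n mulr0 subr0 mulr1.
Qed.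

Lemma expi0 : expi 0 = 1 :> R[i].
Proof. by rewrite /expi cos0 sin0. Qed.

Lemma expiD (x y : R) : expi (x + y) = expi x * expi y.
Proof.
rewrite /expi cosD sinD.
by apply/eqP; rewrite eq_complex /= eqxx /= addrC.
Qed.

Lemma conj_expi (x : R) : (expi x)^* = expi (- x).
Proof. by rewrite /expi cosN sinN. Qed.

Lemma expi_2pi : expi (2 * pi) = 1 :> R[i].
Proof. by rewrite mulrC mulr_natr /expi cos2pi sin2pi. Qed.

Lemma expiMz (m : int) (x : R) : expi x = 1 -> expi (m%:~R * x) = 1.
Proof.
move=> hx; have hn (n : nat) : expi (n%:R * x) = 1.
  elim: n => [|n IHn]; first by rewrite mul0r expi0.
  by rewrite mulrS mulrDl mul1r expiD hx IHn mul1r.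
case: m => n; first exact: hn.
by rewrite NegzE mulrNz mulNr -conj_expi hn rmorph1.
Qed.

Lemma Cintegrable_expi (m : int) :
  Cintegrable `[0, 2 * pi[ (fun phi => expi (m%:~R * phi)).
Proof.
have [cc cs] := continuous_expi m.
by split; apply: continuous_integrable_co.
Qed.

Lemma Cintegral_expi (m : int) :
  Cintegral `[0, 2 * pi[ (fun phi : R => expi (m%:~R * phi)) =
  ((m == 0)%:R * (2 * pi))%:C%C.
Proof.
have [cc cs] := continuous_expi m.
have pi2 : 0 < 2 * pi :> R by rewrite mulr_gt0 // pi_gt0.
(* Adding the endpoint $2\pi$, a null set, allows the fundamental theorem on a closed interval. *)
rewrite /Cintegral /expi /= !Rintegral_itv_bndo_bndc;
  try exact: continuous_integrable_co.
have [->|m0] := eqVneq m 0.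
  under [X in (X +i* _)%C]eq_Rintegral do rewrite mul0r cos0.
  under [X in (_ +i* X)%C]eq_Rintegral do rewrite mul0r sin0.
  have cst1 : continuous (fun _ : R => 1 : R) by move=> x; exact: cvg_cst.
  have cst0 : continuous (fun _ : R => 0 : R) by move=> x; exact: cvg_cst.
  have d1 (x : R) : is_derive x 1 (@id R) 1 by exact: is_derive_id.
  have d0 (x : R) : is_derive x 1 (fun _ : R => 0 : R) 0 by exact: is_derive_cst.
  rewrite (FTC2_derive pi2 cst1 d1) (FTC2_derive pi2 cst0 d0).
  by rewrite /= mul1r !subr0.
have m0' : m%:~R != 0 :> R by rewrite intr_eq0.
(* Periodicity yields $\cos(2\pi m)=1$ and $\sin(2\pi m)=0$, the boundary values of the
   antiderivatives. *)
have /eqP := expiMz m expi_2pi.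
rewrite eq_complex /= => /andP[/eqP c1 /eqP s0].
pose l : R -> R := m%:~R \*: @id R.
have dS (x : R) : is_derive x 1 (m%:~R^-1 \*: (sin \o l)) (cos (m%:~R * x)).
  apply: is_derive_eq; rewrite /GRing.scale /= mulr1 mulrCA mulVf ?mulr1 //.
have dC (x : R) :
    is_derive x 1 (- m%:~R^-1 \*: (cos \o l)) (sin (m%:~R * x)).
  apply: is_derive_eq; rewrite /GRing.scale /= mulr1 !mulNr mulrN opprK.
  by rewrite mulrCA mulVf ?mulr1.
rewrite (FTC2_derive pi2 cc dS) (FTC2_derive pi2 cs dC).
rewrite /= /l /= /GRing.scale /=.
by rewrite s0 c1 !mulr0 sin0 cos0 !mulr0 !subrr mul0r.
Qed.

End ComplexIntegral.

(** * The inner product and orthonormality of the Zernike functions *)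

Section InnerProduct.
Variable R : realType.
Local Notation mu := (@lebesgue_measure R).

Lemma eq_inner (f f' g g' : polar_fun R) :
  (forall r phi, in_disk r phi -> f r phi = f' r phi) ->
  (forall r phi, in_disk r phi -> g r phi = g' r phi) ->
  inner f g = inner f' g'.
Proof.
move=> ff' gg'; apply: eq_Cintegral => r; rewrite inE /= in_itv /= => r01.
apply: eq_Cintegral => phi; rewrite inE /= in_itv /= => phi2.
by rewrite ff' ?gg'.
Qed.

(** Every term separates into a radial and an angular factor; the angular integral keeps only pairs
    of equal frequency, with weight $2\pi$. *)
Lemma inner_sum (I J : Type) (s : seq I) (s' : seq J) (c : I -> R[i])
    (d : J -> R[i]) (p : I -> R -> R) (q : J -> R -> R) (m : I -> int)
    (n : J -> int) :
  (forall i, continuous (p i)) -> (forall j, continuous (q j)) ->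
  inner
    (fun r phi => \sum_(i <- s) c i * ((p i r)%:C%C * expi ((m i)%:~R * phi)))
    (fun r phi => \sum_(j <- s') d j * ((q j r)%:C%C * expi ((n j)%:~R * phi))) =
  \sum_(i <- s) \sum_(j <- s') c i * (d j)^* *
    ((m i == n j)%:R * (2 * pi) * \int[mu]_(r in `[0, 1]) (p i r * q j r * r))%:C%C.
Proof.
(* The product of the two sums becomes one sum over pairs, so that [Cintegral_sum] serves both
   integrations. *)
move=> cp cq; pose S := [seq (i, j) | i <- s, j <- s'].
pose C k := c k.1 * (d k.2)^*; pose P k r := p k.1 r * q k.2 r * r.
have cP k : continuous (P k).
  by move=> x; apply: cvgM; [apply: cvgM; [exact: cp|exact: cq]|exact: cvg_id].
have ICP k : Cintegrable `[0, 1] (fun r => (P k r)%:C%C).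
  split; first exact: (@continuous_integrable _ _ _ (P k)) (cP k).
  by apply: (@continuous_integrable _ _ _ (fun=> 0)) => x; exact: cvg_cst.
transitivity (Cintegral `[0, 1] (fun r : R => \sum_(k <- S)
    (C k * ((m k.1 - n k.2 == 0)%:R * (2 * pi))%:C%C) * (P k r)%:C%C)).
  apply: eq_Cintegral => r _.
  transitivity (Cintegral `[0, 2 * pi[ (fun phi : R => \sum_(k <- S)
      (C k * (P k r)%:C%C) * expi ((m k.1 - n k.2)%:~R * phi))).
    apply: eq_Cintegral => phi _; rewrite rmorph_sum /= !mulr_suml big_allpairs.
    apply: eq_bigr => i _; rewrite mulr_sumr mulr_suml; apply: eq_bigr => j _.
    rewrite /C /P /= rmorphM /= rmorphM /= conj_expi.
    rewrite intrD mulrDl expiD rmorphN mulNr.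
    have -> : ((q j r)%:C%C)^* = (q j r)%:C%C by exact: conjc_real.
    by rewrite !rmorphM /=; ring.
  rewrite Cintegral_sum //; last by move=> k; exact: Cintegrable_expi.
  by apply: eq_bigr => k _; rewrite Cintegral_expi mulrAC.
rewrite Cintegral_sum // big_allpairs; apply: eq_bigr => i _.
apply: eq_bigr => j _; rewrite CintegralC /C /P /= subr_eq0 -mulrA.
by rewrite -rmorphM.
Qed.

Lemma continuous_sumr (I : Type) (s : seq I) (f : I -> R -> R) :
  (forall i, continuous (f i)) -> continuous (fun x => \sum_(i <- s) f i x).
Proof.
move=> cf x; apply: cvg_big => [|i _]; first exact: add_continuous.
exact: cf.
Qed.

Lemma Rintegral_sum (I : Type) (s : seq I) (f : I -> R -> R) :
  (forall i, continuous (f i)) ->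
  \int[mu]_(r in `[0, 1]) (\sum_(i <- s) f i r) =
  \sum_(i <- s) \int[mu]_(r in `[0, 1]) f i r.
Proof.
move=> cf; elim: s => [|i s IHs].
  under eq_Rintegral do rewrite big_nil.
  by rewrite big_nil /Rintegral integral0_eq.
under eq_Rintegral do rewrite big_cons.
rewrite RintegralD ?IHs ?big_cons //; apply: continuous_integrable => //.
by apply: continuous_sumr.
Qed.

Lemma continuous_radial n m : continuous (@radial R n m).
Proof.
apply: continuous_sumr => s x; apply: cvgM; first exact: cvg_cst.
exact: exprn_continuous.
Qed.

(** Termwise integration: of the shift by 2 in the denominators, one unit comes from the weight $r$
    and one from the antiderivative. *)
Lemma radial_power_integral m b k :
  \int[mu]_(r in `[0, 1]) (radial (m + 2 * b) m r * r ^+ k * r) =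
  \sum_(t < b.+1) radial_coef R m b t / (m + 2 * t + k + 2)%:R.
Proof.
transitivity (\int[mu]_(r in `[0, 1])
    (\sum_(t < b.+1) radial_coef R m b t * r ^+ (m + 2 * t + k).+1)).
  apply: eq_Rintegral => r _; rewrite radialE !mulr_suml; apply: eq_bigr => t _.
  by rewrite exprSr [r ^+ (_ + k)]exprD !mulrA.
rewrite Rintegral_sum => [|t x]; last first.
  apply: cvgM; [exact: cvg_cst|exact: exprn_continuous].
apply: eq_bigr => t _; rewrite RintegralZl ?Rintegral_pow ?addn2 //.
by apply: continuous_integrable; exact: exprn_continuous.
Qed.

(** The factor of lower degree is expanded in powers; the moments of the other vanish except
    possibly the last one, and that one survives only if $b=b'$. *)
Lemma radial_orthogonal m b b' :
  \int[mu]_(r in `[0, 1]) (radial (m + 2 * b) m r * radial (m + 2 * b') m r * r) =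
  if b == b' then (2 * (m + 2 * b).+1%:R)^-1 else 0.
Proof.
wlog bb : b b' / (b' <= b)%N => [H|].
  case: (leqP b' b) => [/H //|/ltnW /H {}H].
  under eq_Rintegral do rewrite [X in X * _]mulrC.
  by rewrite H eq_sym; case: eqP => [->|].
transitivity (\int[mu]_(r in `[0, 1]) \sum_(t < b'.+1) radial_coef R m b' t *
    (radial (m + 2 * b) m r * r ^+ (m + 2 * t) * r)).
  apply: eq_Rintegral => r _; rewrite [radial (m + 2 * b') _ _]radialE.
  rewrite mulr_sumr mulr_suml; apply: eq_bigr => t _.
  by rewrite mulrCA !mulrA.
have cr k : continuous (fun r : R => radial (m + 2 * b) m r * r ^+ k * r).
  move=> x; apply: cvgM; last exact: cvg_id.
  by apply: cvgM; [exact: continuous_radial|exact: exprn_continuous].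
rewrite Rintegral_sum => [|t x]; last first.
  by apply: cvgM; [exact: cvg_cst|exact: cr].
under eq_bigr => t _.
  rewrite RintegralZl //; last by apply: continuous_integrable; exact: cr.
  rewrite radial_power_integral.
  over.
rewrite big_ord_recr /= big1 => [|t _]; last first.
  by rewrite radial_moment0 ?mulr0 // (leq_trans _ bb).
rewrite add0r; case: eqP => [<-|/eqP nb]; first exact: radial_moment_lead.
by rewrite radial_moment0 ?mulr0 // ltn_neqAle eq_sym nb.
Qed.

Definition zernike_index (k : nat * int) : bool :=
  (`|k.2|%N <= k.1)%N && (2 %| k.1%:Z - k.2)%Z.

Lemma zernike_indexP k : zernike_index k ->
  k.1 = (`|k.2| + 2 * ((k.1 - `|k.2|)./2))%N.
Proof. by case: k => n m; rewrite /zernike_index /= => /andP[mn d]; lia. Qed.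

Local Notation Z k := (@zernike R k.1 k.2).

Definition radial_normed (k : nat * int) (r : R) : R :=
  Num.sqrt (k.1.+1%:R / pi) * radial k.1 `|k.2|%N r.

Lemma continuous_radial_normed k : continuous (radial_normed k).
Proof.
by move=> x; apply: cvgM; [exact: cvg_cst|exact: continuous_radial].
Qed.

(** The constants match: $\frac{n+1}{\pi}\cdot 2\pi\cdot\frac{1}{2(n+1)}=1$. Equal frequencies allow
    both degrees to be written as $|m|+2b$ and $|m|+2b'$. *)
Lemma radial_normed_orthonormal (k j : nat * int) :
  zernike_index k -> zernike_index j ->
  (k.2 == j.2)%:R * (2 * pi) *
    \int[mu]_(r in `[0, 1]) (radial_normed k r * radial_normed j r * r) =
  (k == j)%:R.
Proof.
case: k j => [n m] [n' m'] ak aj; rewrite xpair_eqE /=.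
have [e|_] := eqVneq m m'; last by rewrite andbF !mul0r.
rewrite -{m'}e in aj *; rewrite andbT mul1r.
have := zernike_indexP ak; have := zernike_indexP aj => /=.
move: (n - _)./2 (n' - _)./2 => b b' -> ->.
rewrite /radial_normed /=; set M := `|m|%N.
pose C : R := Num.sqrt ((M + 2 * b).+1%:R / pi) * Num.sqrt ((M + 2 * b').+1%:R / pi).
transitivity (2 * pi * \int[mu]_(r in `[0, 1])
    (C * (radial (M + 2 * b) M r * radial (M + 2 * b') M r * r))).
  by congr (_ * _); apply: eq_Rintegral => r _; rewrite /C; ring.
rewrite RintegralZl //; last first.
  apply: continuous_integrable => x; apply: cvgM; last exact: cvg_id.
  by apply: cvgM; exact: continuous_radial.
rewrite radial_orthogonal eqn_add2l eqn_pmul2l //.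
have [bb|_] := eqVneq b b'; last by rewrite !mulr0.
have pi0 : pi != 0 :> R by rewrite gt_eqF ?pi_gt0.
rewrite /C bb -expr2 sqr_sqrtr; last by rewrite divr_ge0 ?pi_ge0.
have n0 : (M + 2 * b').+1%:R != 0 :> R by rewrite pnatr_eq0.
rewrite mulr1n; move: (M + 2 * b').+1%:R n0 => x x0; move: (pi : R) pi0 => q q0.
by field; rewrite q0 x0.
Qed.

Lemma zernikeE k r phi :
  Z k r phi = (radial_normed k r)%:C%C * expi (k.2%:~R * phi).
Proof. by rewrite /zernike /radial_normed rmorphM. Qed.

Lemma zernike_inner (s : seq (nat * int)) (c d : nat * int -> R[i]) :
  uniq s -> all zernike_index s ->
  inner (fun r phi => \sum_(k <- s) c k * Z k r phi)
        (fun r phi => \sum_(k <- s) d k * Z k r phi) =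
  \sum_(k <- s) c k * (d k)^*.
Proof.
move=> us /allP as_.
pose F k r phi := (radial_normed k r)%:C%C * expi (k.2%:~R * phi).
transitivity (inner (fun r phi => \sum_(k <- s) c k * F k r phi)
                    (fun r phi => \sum_(k <- s) d k * F k r phi)).
  by apply: eq_inner => r phi _; apply: eq_bigr => k _; rewrite zernikeE.
rewrite inner_sum; try exact: continuous_radial_normed.
rewrite [LHS]big_seq [RHS]big_seq; apply: eq_bigr => k ks.
rewrite (bigD1_seq k) //= radial_normed_orthonormal ?as_ // eqxx mulr1.
rewrite big_seq_cond big1 ?addr0 // => j /andP[js jk].
by rewrite radial_normed_orthonormal ?as_ // eq_sym (negPf jk) mulr0.
Qed.

End InnerProduct.

(** * The Zernike functions of degree at most N span V N *)

Section PolynomialSpace.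
Variable R : realType.
Local Notation Z k := (@zernike R k.1 k.2).

Definition zernike_indices N : seq (nat * int) :=
  [seq (n, m) | n <- index_iota 0 N.+1, m <- zernike_range n].

Lemma mem_zernike_range n m :
  (m \in zernike_range n) = zernike_index (n, m).
Proof.
rewrite mem_filter /zernike_index andbC; congr (_ && _).
apply/mapP/idP => [[x] | mn]; first by rewrite mem_iota => ? -> /=; lia.
have {}mn : (`|m| <= n)%N := mn.
(* The list starts at $-n$, so $m$ sits at position $m+n\ge 0$. *)
exists (absz (m + n%:Z)).
  by rewrite mem_iota; lia.
by lia.
Qed.

Lemma mem_zernike_indices N k :
  (k \in zernike_indices N) = (k.1 <= N)%N && zernike_index k.
Proof.
case: k => n m; apply/allpairsPdep/andP => [[n' [m' []]] | [nN i]].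
  by rewrite mem_index_iota mem_zernike_range => ? ? [-> ->].
by exists n, m; rewrite mem_index_iota mem_zernike_range.
Qed.

Lemma uniq_zernike_indices N : uniq (zernike_indices N).
Proof.
apply: allpairs_uniq_dep; first exact: iota_uniq.
  by move=> n _; rewrite filter_uniq // map_inj_uniq ?iota_uniq // => i j; lia.
by move=> [n m] [n' m'] _ _ /= [-> ->].
Qed.

Lemma kernel_polyE N (rho theta : R) r phi :
  kernel_poly N rho theta r phi =
  \sum_(k <- zernike_indices N) (Z k rho theta)^* * Z k r phi.
Proof. by rewrite /kernel_poly big_allpairs_dep. Qed.

Definition in_zernike_span N (f : polar_fun R) : Prop :=
  exists c : nat * int -> R[i], forall r phi, in_disk r phi ->
    f r phi = \sum_(k <- zernike_indices N) c k * Z k r phi.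

Lemma eq_zernike_span N (f g : polar_fun R) :
  (forall r phi, in_disk r phi -> f r phi = g r phi) ->
  in_zernike_span N g -> in_zernike_span N f.
Proof. by move=> fg [c gc]; exists c => r phi h; rewrite fg ?gc. Qed.

Lemma zernike_spanZ N a (f : polar_fun R) : in_zernike_span N f ->
  in_zernike_span N (fun r phi => a * f r phi).
Proof.
move=> [c fc]; exists (fun k => a * c k) => r phi h.
by rewrite fc // mulr_sumr; apply: eq_bigr => k _; rewrite mulrA.
Qed.

Lemma zernike_span_sum N (I : eqType) (s : seq I) (f : I -> polar_fun R) :
  (forall i, i \in s -> in_zernike_span N (f i)) ->
  in_zernike_span N (fun r phi => \sum_(i <- s) f i r phi).
Proof.
elim: s => [|i s IHs] H.
  by exists (fun=> 0) => r phi _; rewrite big_nil big1 // => k _; rewrite mul0r.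
have [c fc] := H i (mem_head _ _).
have [d fd] := IHs (fun j js => H j (mem_behead (s := i :: s) js)).
exists (fun k => c k + d k) => r phi h; rewrite big_cons fc // fd // -big_split.
by apply: eq_bigr => k _; rewrite mulrDl.
Qed.

Lemma zernike_span_zernike N k : k \in zernike_indices N ->
  in_zernike_span N (Z k).
Proof.
move=> kN; exists (fun j => (j == k)%:R) => r phi _.
rewrite (bigD1_seq k) ?uniq_zernike_indices //= eqxx mul1r.
by rewrite big1 ?addr0 // => j /negPf ->; rewrite mul0r.
Qed.

(** With $z=re^{i\phi}$ this is $z^a\bar z^b$ for $a-b=m$ and $\min(a,b)=t$. *)
Definition mode (m : int) (t : nat) : polar_fun R :=
  fun r phi => (r ^+ (`|m| + 2 * t))%:C%C * expi (m%:~R * phi).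

Lemma zernike_mode m b r phi :
  zernike (`|m| + 2 * b) m r phi = \sum_(t < b.+1)
    (Num.sqrt ((`|m| + 2 * b).+1%:R / pi) * radial_coef R `|m|%N b t)%:C%C *
    mode m t r phi.
Proof.
rewrite /zernike radialE rmorph_sum mulr_sumr mulr_suml.
by apply: eq_bigr => t _; rewrite /mode !rmorphM !mulrA.
Qed.

(** Strong induction on $t$ inverts the triangular system [zernike_mode]: the Zernike function of
    degree $|m|+2t$ is a nonzero multiple of this mode plus lower modes. *)
Lemma zernike_span_mode N m t : (`|m| + 2 * t <= N)%N ->
  in_zernike_span N (mode m t).
Proof.
elim/ltn_ind: t => t IHt mtN.
pose a (u : 'I_t.+1) : R[i] := (Num.sqrt ((`|m| + 2 * t).+1%:R / pi) *
  radial_coef R `|m|%N t u)%:C%C.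
have a0 : a ord_max != 0.
  rewrite /a fmorph_eq0 mulf_neq0 ?radial_coef_lead_neq0 //.
  by rewrite sqrtr_eq0 -ltNge divr_gt0 ?pi_gt0.
(* The difference is phrased as a sum over two labels, [Some tt] for the Zernike function and [None]
   for the lower modes, so that [zernike_span_sum] covers it. *)
apply: (@eq_zernike_span _ _ (fun r phi => (a ord_max)^-1 *
  (\sum_(o <- [:: Some tt; None])
    if o then zernike (`|m| + 2 * t) m r phi
    else (-1) * \sum_(u <- index_enum 'I_t)
       a (widen_ord (leqnSn t) u) * mode m u r phi))).
  move=> r phi _; rewrite !big_cons big_nil addr0 zernike_mode big_ord_recr /=.
  by rewrite mulN1r addrAC subrr add0r mulrA mulVf ?mul1r.
apply: zernike_spanZ; apply: zernike_span_sum => -[[]|] _.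
  apply: (@zernike_span_zernike N ((`|m| + 2 * t)%N, m)).
  by rewrite mem_zernike_indices mtN /zernike_index /=; lia.
apply: zernike_spanZ; apply: zernike_span_sum => u _; apply: zernike_spanZ.
by apply: IHt; have := ltn_ord u; lia.
Qed.

Definition zcoord (r phi : R) : R[i] := r%:C%C * expi phi.

Lemma mode_zcoord a b r phi :
  mode (a%:Z - b%:Z) (minn a b) r phi = zcoord r phi ^+ a * (zcoord r phi)^* ^+ b.
Proof.
have expiX (x : R) n : expi x ^+ n = expi (n%:R * x).
  elim: n => [|n IHn]; first by rewrite mul0r expi0.
  by rewrite exprS IHn -expiD mulrS mulrDl mul1r.
rewrite /zcoord rmorphM /= conj_expi.
have -> : (r%:C%C)^* = r%:C%C :> R[i] by exact: conjc_real.
rewrite !exprMn mulrACA -exprD !expiX -expiD /mode.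
have -> : (`|a%:Z - b%:Z| + 2 * minn a b = a + b)%N by lia.
have -> : (r ^+ (a + b))%:C%C = r%:C%C ^+ (a + b) by exact: rmorphXn.
by rewrite intrD mulrDl mulrNz mulNr mulrN.
Qed.

Lemma zernike_span_zcoord N a b : (a + b <= N)%N ->
  in_zernike_span N (fun r phi => zcoord r phi ^+ a * (zcoord r phi)^* ^+ b).
Proof.
move=> abN; apply: (@eq_zernike_span _ _ (mode (a%:Z - b%:Z) (minn a b))).
  by move=> r phi _; rewrite mode_zcoord.
by apply: zernike_span_mode; lia.
Qed.

Lemma cart_zcoord (r phi : R) :
  ((cart r phi).1)%:C%C = (zcoord r phi + (zcoord r phi)^* ) / 2 /\
  ((cart r phi).2)%:C%C = (zcoord r phi - (zcoord r phi)^* ) / (2 * 'i%C).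
Proof.
have zE : zcoord r phi = ((r * cos phi) +i* (r * sin phi))%C.
  by rewrite /zcoord /expi; apply/eqP; rewrite eq_complex /= !mul0r subr0 addr0 !eqxx.
have i0 : 2 * 'i%C != 0 :> R[i].
  by rewrite mulf_neq0 ?pnatr_eq0 // eq_complex /= oner_eq0 andbF.
rewrite zE /cart /=; split.
  apply: (@mulIf _ 2); first by rewrite pnatr_eq0.
  rewrite divfK ?pnatr_eq0 // mulr2n mulrDr mulr1.
  by apply/eqP; rewrite eq_complex /= addr0 subrr !eqxx.
apply: (mulIf i0); rewrite divfK // mulr2n mulrDl mul1r mulrDr.
by apply/eqP; rewrite eq_complex /=; apply/andP; split; apply/eqP; ring.
Qed.

(** Expanding $((z+\bar z)/2)^a((z-\bar z)/(2i))^b$ binomially gives only monomials in $z,\bar z$ of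
    total degree $a+b$. *)
Lemma zernike_span_xy N a b : (a + b <= N)%N ->
  in_zernike_span N (fun r phi =>
    ((cart r phi).1)%:C%C ^+ a * ((cart r phi).2)%:C%C ^+ b).
Proof.
move=> abN.
apply: (@eq_zernike_span _ _ (fun r phi =>
  \sum_(i <- index_enum 'I_a.+1) \sum_(j <- index_enum 'I_b.+1)
    ((2^-1) ^+ a * (2 * 'i%C)^-1 ^+ b * 'C(a, i)%:R * ((-1) ^+ j * 'C(b, j)%:R)) *
    (zcoord r phi ^+ (a - i + (b - j)) * (zcoord r phi)^* ^+ (i + j)))).
  move=> r phi _; have [-> ->] := cart_zcoord r phi.
  rewrite !exprMn exprDn exprBn mulrACA mulr_suml mulr_suml.
  apply: eq_bigr => i _; rewrite mulr_sumr mulr_suml; apply: eq_bigr => j _.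
  rewrite !exprD -[_ *+ 'C(a, i)]mulr_natr -[_ *+ 'C(b, j)]mulr_natr.
  by ring.
apply: zernike_span_sum => i _; apply: zernike_span_sum => j _.
apply: zernike_spanZ; apply: zernike_span_zcoord.
by have := ltn_ord i; have := ltn_ord j; lia.
Qed.

Lemma V_zernike_span N (f : polar_fun R) : V N f -> in_zernike_span N f.
Proof.
move=> [p [sp fp]].
apply: (@eq_zernike_span _ _ (fun r phi => \sum_(m <- msupp p)
  mcoeff m p * (((cart r phi).1)%:C%C ^+ (m ord0) * ((cart r phi).2)%:C%C ^+ (m ord_max)))).
  move=> r phi h; rewrite fp // mevalE; apply: eq_bigr => m _.
  by rewrite big_ord_recl big_ord1 /=; congr (_ * (_ * _ ^+ m _)); apply: val_inj.
apply: zernike_span_sum => m mp; apply: zernike_spanZ; apply: zernike_span_xy.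
(* Since [msize] exceeds the degree by one, every monomial in the support has degree at most [N]. *)
have := leq_trans (msize_mdeg_lt mp) sp; rewrite ltnS mdegE big_ord_recl big_ord1 /=.
by congr (_ + m _ <= _)%N; apply: val_inj.
Qed.

End PolynomialSpace.

(** * Zernike functions as polynomials, coordinates and conjugation symmetry *)

Section SpanInV.
Variable R : realType.
Local Notation Z k := (@zernike R k.1 k.2).

Lemma V_le M N (f : polar_fun R) : (M <= N)%N -> V M f -> V N f.
Proof. by move=> MN [p [sp fp]]; exists p; split=> //; apply: leq_trans sp _. Qed.

Lemma eq_V N (f g : polar_fun R) :
  (forall r phi, in_disk r phi -> f r phi = g r phi) -> V N g -> V N f.
Proof. by move=> fg [p [sp gp]]; exists p; split=> // r phi h; rewrite fg ?gp. Qed.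

Lemma V_sum N (I : eqType) (s : seq I) (f : I -> polar_fun R) :
  (forall i, i \in s -> V N (f i)) -> V N (fun r phi => \sum_(i <- s) f i r phi).
Proof.
elim: s => [|i s IHs] H.
  by exists 0; rewrite msize0; split=> // r phi _; rewrite big_nil meval0.
have [p [sp fp]] := H i (mem_head _ _).
have [q [sq fq]] := IHs (fun j js => H j (mem_behead (s := i :: s) js)).
exists (p + q); split=> [|r phi h].
  by apply: leq_trans (msizeD_le _ _) _; rewrite geq_max sp.
by rewrite big_cons mevalD fp // fq.
Qed.

Lemma VZ N a (f : polar_fun R) : V N f -> V N (fun r phi => a * f r phi).
Proof.
move=> [p [sp fp]]; exists (a *: p); split=> [|r phi h].
  exact: leq_trans (msizeZ_le _ _) sp.
by rewrite mevalZ fp.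
Qed.

Lemma VM M N (f g : polar_fun R) :
  V M f -> V N g -> V (M + N) (fun r phi => f r phi * g r phi).
Proof.
move=> [p [sp fp]] [q [sq gq]]; exists (p * q); split=> [|r phi h].
  (* The product formula for [msize] holds for nonzero factors only. *)
  have [->|p0] := eqVneq p 0; first by rewrite mul0r msize0.
  have [->|q0] := eqVneq q 0; first by rewrite mulr0 msize0.
  have := leq_add sp sq; rewrite addSn addnS => h.
  by rewrite msizeM // -subn1 leq_subLR add1n.
by rewrite mevalM fp // gq.
Qed.

Lemma VX N n (f : polar_fun R) : V N f -> V (N * n) (fun r phi => f r phi ^+ n).
Proof.
move=> Vf; elim: n => [|n IHn].
  exists 1; rewrite msize1; split=> // r phi _; by rewrite meval1.
rewrite mulnS; apply: (eq_V _ (VM Vf IHn)) => r phi _; exact: exprS.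
Qed.

Lemma V_zcoord : V 1 (@zcoord R) /\ V 1 (fun r phi => (@zcoord R r phi)^*).
Proof.
(* The single family $x+ay$ provides $z$ at $a=i$ and $\bar z$ at $a=-i$. *)
have V1 (a : R[i]) : V 1 (fun r phi => ((cart r phi).1)%:C%C + a * ((cart r phi).2)%:C%C).
  exists (mpolyX R[i] (mnm1 ord0) + a *: mpolyX R[i] (mnm1 ord_max)); split=> [|r phi _].
    apply: leq_trans (msizeD_le _ _) _; rewrite geq_max msizeX mdeg1 /=.
    by apply: leq_trans (msizeZ_le _ _) _; rewrite msizeX mdeg1.
  by rewrite mevalD mevalZ !mevalXU.
split; [apply: eq_V (V1 'i%C)|apply: eq_V (V1 (- 'i%C))] => r phi _;
  rewrite /zcoord /expi /cart /=; apply/eqP; rewrite eq_complex /=;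
  apply/andP; split; apply/eqP; ring.
Qed.

Lemma V_mode N m t : (`|m| + 2 * t <= N)%N -> V N (@mode R m t).
Proof.
move=> mtN; have [Vz Vz'] := V_zcoord.
have Vab a b : (a + b <= N)%N -> V N (@mode R (a%:Z - b%:Z) (minn a b)).
  move=> abN; apply: (V_le abN).
  have := VM (VX a Vz) (VX b Vz'); rewrite !mul1n; apply: eq_V => r phi _.
  exact: mode_zcoord.
(* The exponents of $z$ and $\bar z$ are $(|m|+t,t)$ or $(t,|m|+t)$, according to the sign of
   $m$. *)
have [m0|m0] := leP 0 m.
  have -> : m = (`|m| + t)%N%:Z - t%:Z by lia.
  have {3}-> : t = minn (`|m| + t) t by lia.
  by apply: Vab; lia.
have -> : m = t%:Z - (`|m| + t)%N%:Z by lia.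
have {3}-> : t = minn t (`|m| + t) by lia.
by apply: Vab; lia.
Qed.

Lemma V_zernike N k : k \in zernike_indices N -> V N (Z k).
Proof.
rewrite mem_zernike_indices => /andP[kN /zernike_indexP e].
move: e kN; move: (_./2) => b; case: k => n m /= -> mbN.
apply: (eq_V (fun r phi _ => zernike_mode _ _ r phi)).
apply: V_sum => t _; apply: VZ; apply: V_mode.
by have := ltn_ord t; lia.
Qed.

Lemma zernike_span_V N (f : polar_fun R) : in_zernike_span N f -> V N f.
Proof.
move=> [c fc]; apply: (eq_V fc); apply: V_sum => k kN; apply: VZ.
exact: V_zernike.
Qed.

Lemma zernike_inner_disk N (c d : nat * int -> R[i]) (f g : polar_fun R) :
  (forall r phi, in_disk r phi ->
    f r phi = \sum_(k <- zernike_indices N) c k * Z k r phi) ->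
  (forall r phi, in_disk r phi ->
    g r phi = \sum_(k <- zernike_indices N) d k * Z k r phi) ->
  inner f g = \sum_(k <- zernike_indices N) c k * (d k)^*.
Proof.
move=> fc gd; rewrite (eq_inner fc gd) zernike_inner ?uniq_zernike_indices //.
by apply/allP => k; rewrite mem_zernike_indices => /andP[].
Qed.

(** Places expansions of different degree on one index list, as [zernike_inner_disk] requires. *)
Lemma zernike_sum_le M N (F : nat * int -> R[i]) : (M <= N)%N ->
  \sum_(k <- zernike_indices M) F k =
  \sum_(k <- zernike_indices N | (k.1 <= M)%N) F k.
Proof.
move=> MN; rewrite -[RHS]big_filter; apply: perm_big; apply: uniq_perm.
- exact: uniq_zernike_indices.
- by rewrite filter_uniq // uniq_zernike_indices.
move=> k; rewrite mem_filter !mem_zernike_indices andbA.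
by congr (_ && _); apply/idP/andP => [kM|[]//]; rewrite kM (leq_trans kM).
Qed.

Lemma zernikeN n m r phi : (@zernike R n m r phi)^* = zernike n (- m) r phi.
Proof.
rewrite /zernike abszN rmorphM rmorphM /= conj_expi mulrNz mulNr.
by congr (_ * _ * _); exact: conjc_real.
Qed.

Lemma zernike_sumN N (F : nat * int -> R[i]) :
  \sum_(k <- zernike_indices N) F k =
  \sum_(k <- zernike_indices N) F (k.1, - k.2).
Proof.
rewrite -(big_map (fun k => (k.1, - k.2)) xpredT F).
have inj : injective (fun k : nat * int => (k.1, - k.2)).
  by move=> [a b] [a' b'] [-> /oppr_inj ->].
apply: perm_big; apply: uniq_perm; first exact: uniq_zernike_indices.
  by rewrite map_inj_uniq // uniq_zernike_indices.
have sub k : k \in zernike_indices N -> (k.1, - k.2) \in zernike_indices N.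
  rewrite !mem_zernike_indices /zernike_index /= => /andP[-> /andP[? ?]] /=; lia.
move=> k; apply/idP/mapP => [/sub kN|[j /sub jN ->]//].
by exists (k.1, - k.2); rewrite //= opprK -surjective_pairing.
Qed.

End SpanInV.

(** * Wavelets *)

Section Wavelets.
Variable R : realType.
Local Notation Z k := (@zernike R k.1 k.2).
Implicit Types (N : nat) (mu omega : R).

Definition wavelet_coef N mu omega (k : nat * int) : R[i] :=
  if (N < k.1)%N then (Z k mu omega)^* else 0.

Lemma kernel_coefE N mu omega r phi : kernel_poly N mu omega r phi =
  \sum_(k <- zernike_indices (2 * N))
    (if (k.1 <= N)%N then (Z k mu omega)^* else 0) * Z k r phi.
Proof.
rewrite kernel_polyE (@zernike_sum_le _ N (2 * N)) ?leq_pmull // big_mkcond.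
by apply: eq_bigr => k _; case: ifP => _; rewrite ?mul0r.
Qed.

Lemma wavelet_coefE N mu omega r phi : wavelet N mu omega r phi =
  \sum_(k <- zernike_indices (2 * N)) wavelet_coef N mu omega k * Z k r phi.
Proof.
rewrite /wavelet [X in _ - X]kernel_coefE kernel_polyE -sumrB; apply: eq_bigr => k _.
by rewrite /wavelet_coef ltnNge -mulrBl; case: leqP => _; rewrite ?subrr ?subr0.
Qed.

(** In coordinates, the wavelet is the reproducing kernel of $W_N$: pairing with it evaluates at
    [(mu, omega)]. *)
Lemma wavelet_reproducing N mu omega (c : nat * int -> R[i]) :
  (forall k, (k.1 <= N)%N -> k \in zernike_indices (2 * N) -> c k = 0) ->
  \sum_(k <- zernike_indices (2 * N)) c k * (wavelet_coef N mu omega k)^* =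
  \sum_(k <- zernike_indices (2 * N)) c k * Z k mu omega.
Proof.
move=> c0; rewrite big_seq [RHS]big_seq; apply: eq_bigr => k kN.
rewrite /wavelet_coef; case: ltnP => [_|kle]; first by rewrite conjCK.
by rewrite c0 // !mul0r.
Qed.

(** The substitution $m\mapsto -m$ conjugates both Zernike factors, which exchanges the roles of the
    two points. *)
Lemma wavelet_sym N mu omega mu' omega' :
  wavelet N mu omega mu' omega' = wavelet N mu' omega' mu omega.
Proof.
rewrite !wavelet_coefE zernike_sumN; apply: eq_bigr => k _.
rewrite /wavelet_coef /=; case: ifP => _; last by rewrite !mul0r.
by rewrite -!zernikeN conjCK mulrC.
Qed.

(** Reproduction evaluates the first wavelet at the centre of the second; symmetry then gives the
    stated form. *)
Lemma inner_wavelet N mu omega mu' omega' :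
  inner (wavelet N mu omega) (wavelet N mu' omega') =
  wavelet N mu' omega' mu omega.
Proof.
rewrite (zernike_inner_disk (N := 2 * N) (c := wavelet_coef N mu omega)
  (d := wavelet_coef N mu' omega')); try by move=> *; exact: wavelet_coefE.
rewrite wavelet_reproducing => [|k kN _]; last by rewrite /wavelet_coef ltnNge kN.
by rewrite wavelet_sym -wavelet_coefE.
Qed.

(** The coefficients live on the disjoint ranges $n>N$ and $n\le N$. *)
Lemma inner_wavelet_kernel N mu omega rho theta :
  inner (wavelet N mu omega) (kernel_poly N rho theta) = 0.
Proof.
rewrite (zernike_inner_disk (N := 2 * N) (fun r phi _ => wavelet_coefE N mu omega r phi)
  (fun r phi _ => kernel_coefE N rho theta r phi)).
apply: big1 => k _; rewrite /wavelet_coef; case: leqP => _.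
  by rewrite mul0r.
by rewrite rmorph0 mulr0.
Qed.

Lemma expi_neq0 (x : R) : expi x != 0.
Proof.
apply/eqP => e; have /eqP := expiD x (- x).
by rewrite subrr expi0 e mul0r oner_eq0.
Qed.

(* At the origin only the zonal functions [m = 0] survive. *)
Lemma zernike_neq0 N mu omega : (0 < N)%N ->
  exists2 k, k \in zernike_indices (2 * N) & k.1 = (2 * N)%N /\ Z k mu omega != 0.
Proof.
move=> N0.
have s0 n : Num.sqrt (n.+1%:R / pi) != 0 :> R.
  by rewrite sqrtr_eq0 -ltNge divr_gt0 ?pi_gt0.
have [->|mu0] := eqVneq mu 0.
  exists ((2 * N)%N, 0); first by rewrite mem_zernike_indices leqnn /zernike_index /=; lia.
  split=> //; rewrite /zernike /= mulf_neq0 ?expi_neq0 // mulf_neq0 ?fmorph_eq0 //.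
  rewrite -[(2 * N)%N]add0n radialE big_ord_recl big1 => [|t _]; last first.
    by rewrite expr0n /= mulr0.
  rewrite addr0 expr0 mulr1 /radial_coef bin0 expr0 !mul1r.
  apply: mulf_neq0; last first.
    by apply/prodf_neq0 => i _; rewrite -!natrD pnatr_eq0 addnS.
  by rewrite mulf_neq0 ?signr_eq0 // invr_eq0 pnatr_eq0 -lt0n fact_gt0.
(* For $m=n$ the radial polynomial is a single monomial, nonzero away from the origin. *)
exists ((2 * N)%N, (2 * N)%N%:Z).
  by rewrite mem_zernike_indices leqnn /zernike_index /=; lia.
split=> //; rewrite /zernike /= mulf_neq0 ?expi_neq0 // mulf_neq0 ?fmorph_eq0 //.
have := radialE (2 * N) 0 mu; rewrite muln0 addn0 big_ord1 => ->.
by rewrite mulf_neq0 ?radial_coef_lead_neq0 // expf_neq0.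
Qed.

(** Reproduction applied to the wavelet itself: its value at its own centre is its squared norm. *)
Lemma wavelet_center N mu omega : wavelet N mu omega mu omega =
  \sum_(k <- zernike_indices (2 * N))
    wavelet_coef N mu omega k * (wavelet_coef N mu omega k)^*.
Proof.
rewrite wavelet_reproducing ?wavelet_coefE // => k kN _.
by rewrite /wavelet_coef ltnNge kN.
Qed.

(** The term of degree $2N>N$ from [zernike_neq0] is positive. In the order of [R[i]] this also
    makes the value real. *)
Lemma wavelet_center_gt0 N mu omega : (0 < N)%N ->
  0 < wavelet N mu omega mu omega.
Proof.
move=> N0; have [k kN [k1 Zk]] := zernike_neq0 mu omega N0.
rewrite wavelet_center (bigD1_seq k) ?uniq_zernike_indices //= ltr_wpDr //.
  by apply: sumr_ge0 => j _; exact: mul_conjC_ge0.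
by rewrite mul_conjC_gt0 /wavelet_coef {1}k1 ltn_Pmull // conjC_eq0.
Qed.

(** For $n\le N$ the coefficient is the inner product of [f] with a Zernike function in $V_N$, hence
    0. *)
Lemma W_coef N (f : polar_fun R) : W N f ->
  exists2 c : nat * int -> R[i],
    forall r phi, in_disk r phi ->
      f r phi = \sum_(k <- zernike_indices (2 * N)) c k * Z k r phi &
    forall k, (k.1 <= N)%N -> k \in zernike_indices (2 * N) -> c k = 0.
Proof.
move=> [/V_zernike_span[c fc] orth]; exists c => // k kN k2N.
have VZk : V N (Z k).
  by apply: V_zernike; move: k2N; rewrite !mem_zernike_indices kN => /andP[].
have <- := orth _ VZk.
rewrite (zernike_inner_disk (d := fun j => (j == k)%:R) fc); last first.
  move=> r phi _; rewrite (bigD1_seq k) ?uniq_zernike_indices //= eqxx mul1r.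
  by rewrite big1 ?addr0 // => j /negPf ->; rewrite mul0r.
rewrite (bigD1_seq k) ?uniq_zernike_indices //= eqxx rmorph1 mulr1.
by rewrite big1 ?addr0 // => j /negPf ->; rewrite rmorph0 mulr0.
Qed.

(** The wavelet has no coefficient with $n\le N$, whereas elements of $V_N$, padded with zeros up to
    degree $2N$, have no others. *)
Lemma W_wavelet N mu omega a :
  W N (fun r phi => wavelet N mu omega r phi / a).
Proof.
have wE r phi : wavelet N mu omega r phi / a =
    \sum_(k <- zernike_indices (2 * N)) (wavelet_coef N mu omega k / a) * Z k r phi.
  by rewrite wavelet_coefE mulr_suml; apply: eq_bigr => k _; rewrite mulrAC.
split; first by apply: zernike_span_V; exists (fun k => wavelet_coef N mu omega k / a).
move=> g /V_zernike_span[d gd].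
have gd' r phi : in_disk r phi -> g r phi = \sum_(k <- zernike_indices (2 * N))
    (if (k.1 <= N)%N then d k else 0) * Z k r phi.
  move=> h; rewrite gd // (@zernike_sum_le _ N (2 * N)) ?leq_pmull // big_mkcond.
  by apply: eq_bigr => k _; case: ifP => _; rewrite ?mul0r.
rewrite (zernike_inner_disk (fun r phi _ => wE r phi) gd').
apply: big1 => k _; rewrite /wavelet_coef; case: leqP => _.
  by rewrite !mul0r.
by rewrite rmorph0 mulr0.
Qed.

(* Expanding [0 <= sum |c k - w k / S|^2], where [S = sum |w k|^2]. *)
Lemma wavelet_min N mu omega (f : polar_fun R) : (0 < N)%N ->
  in_disk mu omega -> W N f -> f mu omega = 1 ->
  L2norm (fun r phi => wavelet N mu omega r phi / wavelet N mu omega mu omega)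
    <= L2norm f.
Proof.
move=> N0 dp Wf f1; have [c fc c0] := W_coef Wf.
have S0 := wavelet_center_gt0 mu omega N0.
have SE := wavelet_center N mu omega.
set S := wavelet N mu omega mu omega in S0 SE *.
have wE r phi : wavelet N mu omega r phi / S =
    \sum_(k <- zernike_indices (2 * N)) (wavelet_coef N mu omega k / S) * Z k r phi.
  by rewrite wavelet_coefE mulr_suml; apply: eq_bigr => k _; rewrite mulrAC.
rewrite /L2norm (zernike_inner_disk (fun r phi _ => wE r phi) (fun r phi _ => wE r phi)).
rewrite (zernike_inner_disk fc fc); apply: ler_wsqrtr.
set s := zernike_indices _; set w := wavelet_coef N mu omega.
(* The constraint [f mu omega = 1] turns into an inner product; the expansion of [f] may be
   evaluated there because the point lies in the disk. *)
have cw : \sum_(k <- s) c k * (w k)^* = 1.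
  by rewrite wavelet_reproducing // -fc.
have wc : \sum_(k <- s) w k * (c k)^* = 1.
  rewrite -[RHS](rmorph1 Num.conj) -cw rmorph_sum; apply: eq_bigr => k _.
  by rewrite rmorphM /= conjCK mulrC.
have Sr : S^* = S by apply: CrealP; exact: gtr0_real.
have wS k : (w k / S)^* = (w k)^* / S by rewrite rmorphM fmorphV /= Sr.
(* The squared norm of the normalized wavelet is $S/S^2=1/S$. *)
have ww : \sum_(k <- s) (w k / S) * (w k / S)^* = S^-1.
  transitivity (\sum_(k <- s) (w k * (w k)^*) * (S^-1 * S^-1)).
    by apply: eq_bigr => k _; rewrite wS mulrACA.
  by rewrite -mulr_suml -SE mulrA mulfV ?mul1r // gt_eqF.
suff : \sum_(k <- s) (w k / S) * (w k / S)^* <= \sum_(k <- s) c k * (c k)^*.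
  by rewrite lecE => /andP[].
rewrite -subr_ge0; apply: (@le_trans _ _ (\sum_(k <- s) (c k - w k / S) * (c k - w k / S)^*)).
  by apply: sumr_ge0 => k _; exact: mul_conjC_ge0.
(* Equality holds here: both cross terms equal $1/S$, so the square sums to $\sum|c_k|^2-1/S$. *)
rewrite le_eqVlt; apply/orP; left; apply/eqP.
transitivity (\sum_(k <- s) (c k * (c k)^* + (w k / S) * (w k / S)^*
    - (c k * (w k)^*) / S - (w k * (c k)^*) / S)).
  by apply: eq_bigr => k _; rewrite rmorphB /= wS; ring.
rewrite !sumrB big_split /= -!mulr_suml cw wc ww.
by ring.
Qed.

End Wavelets.

Theorem theorem3p1 (R : realType) (N : nat) (hN : (1 <= N)%N)
    (mu omega : 'I_(dimW N) -> R)
    (hpts : forall j, in_disk (mu j) (omega j)) :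
  let psi := fun j => wavelet N (mu j) (omega j) in
  [/\ forall j k, inner (psi j) (psi k) = psi k (mu j) (omega j),
      forall j,
        is_min [set L2norm f | f in [set f | W N f /\ f (mu j) (omega j) = 1]]
          (L2norm (fun r phi => psi j r phi / psi j (mu j) (omega j)))
    & forall rho theta : 'I_(dimV N) -> R, regular_points rho theta ->
        forall j k, inner (psi j) (kernel_poly N (rho k) (theta k)) = 0].
Proof.
move=> psi; split.
- by move=> j k; exact: inner_wavelet.
- move=> j; split.
    (* The normalized wavelet is itself admissible, so the minimum is attained. *)
    exists (fun r phi => psi j r phi / psi j (mu j) (omega j)) => //.
    split; first exact: W_wavelet.
    by rewrite mulfV // gt_eqF // wavelet_center_gt0.
  by move=> _ [f [Wf f1] <-]; exact: wavelet_min.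
- by move=> rho theta _ j k; exact: inner_wavelet_kernel.
Qed.
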